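(* Let $1 \to N \to G \stackrel{\pi}{\to} H \to 1$ be an abelian extension (a short exact sequence of groups with $N$ abelian). Then the following two sequences are exact: $$1 \to \mathrm{Aut}^{N,H}(G) \to \mathrm{Aut}_N^H(G) \stackrel{\tau_1}{\to} C_1 \stackrel{\lambda_1}{\to} H^2(H,N)$$ and $$1 \to \mathrm{Aut}^{N,H}(G) \to \mathrm{Aut}^N(G) \stackrel{\tau_2}{\to} C_2 \stackrel{\lambda_2}{\to} H^2(H,N),$$ where the maps $\mathrm{Aut}^{N,H}(G)\to \mathrm{Aut}_N^H(G)$ and $\mathrm{Aut}^{N,H}(G)\to\mathrm{Aut}^N(G)$ are inclusions, and exactness at $C_i$ means that the image of $\tau_i$ equals $\{c \in C_i : \lambda_i(c) = 1\}$ for $i=1,2$ (the maps $\lambda_i$ need not be homomorphisms).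
   Context: $N$ is regarded as a normal subgroup of $G$ and $H \cong G/N$. Fix a left transversal $t: H \to G$ (so $\pi(t(x))=x$ for all $x \in H$) with $t(1)=1$. $H$ acts on $N$ on the right by $n^x = t(x)^{-1} n\, t(x)$ (independent of $t$ since $N$ is abelian). Groups are written multiplicatively. A pair $(\theta,\phi)\in \mathrm{Aut}(N)\times\mathrm{Aut}(H)$ is compatible if $\theta(n^x) = \theta(n)^{\phi(x)}$ for all $n\in N$, $x \in H$. Set $C_1 = \{\theta \in \mathrm{Aut}(N) : (\theta,1) \text{ is compatible}\}$ and $C_2 = \{\phi\in\mathrm{Aut}(H) : (1,\phi)\text{ is compatible}\}$. Automorphism groups: $\mathrm{Aut}_N^H(G)$ is the group of automorphisms $\gamma$ of $G$ with $\gamma(N)=N$ inducing the identity on $H$; $\mathrm{Aut}^N(G)$ is the group of automorphisms of $G$ fixing $N$ elementwise; $\mathrm{Aut}^{N,H}(G)$ is the group of automorphisms of $G$ fixing $N$ elementwise and inducing the identity on $H$. The map $\tau_1$ sends $\gamma \in \mathrm{Aut}_N^H(G)$ to its restriction to $N$; the map $\tau_2$ sends $\gamma\in\mathrm{Aut}^N(G)$ to the automorphism of $H$ it induces. Let $\mu: H\times H\to N$ be defined by $t(xy)\mu(x,y) = t(x)t(y)$. A normalized $2$-cocycle is a map $f:H\times H\to N$ with $f(x,1)=f(1,x)=1$ and $f(xy,z)f(x,y)^{z} = f(x,yz)f(y,z)$; a $2$-coboundary is a map of the form $(x,y)\mapsto \chi(x)^{y}\chi(y)\chi(xy)^{-1}$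 with $\chi: H \to N$, $\chi(1)=1$; $H^2(H,N)$ is the quotient group of cocycles by coboundaries. $\lambda_1(\theta)$ is the class in $H^2(H,N)$ of the normalized $2$-cocycle $k_\theta(x,y) = \mu(x,y)\,\theta(\mu(x,y)^{-1})$, for $\theta\in C_1$; $\lambda_2(\phi)$ is the class of the normalized $2$-cocycle $k_\phi(x,y) = \mu(\phi(x),\phi(y))\,\mu(x,y)^{-1}$, for $\phi\in C_2$. These classes do not depend on the choice of $t$. *)

(* Defs.v *)
From HB Require Import structures.
From mathcomp Require Import all_boot.
From mathcomp Require Import boolp classical_sets.

Set Implicit Arguments.
Unset Strict Implicit.
Unset Printing Implicit Defensive.

Local Open Scope quotient_scope.
Local Open Scope classical_set_scope.
Local Open Scope group_scope.

Notation group_morphism := UMagmaMorphism.type.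

Section Subgroups.
Variables (G : groupType) (S : groupClosed G).

Record subgroup := Subgroup { sgval :> G; sgvalP : sgval \in S }.

HB.instance Definition _ := [isSub for sgval].
HB.instance Definition _ := [Choice of subgroup by <:].

Lemma subgroup_closed : group_closed (fun x : G => x \in S).
Proof. by split; [exact: gpred1 | exact: gpredF]. Qed.

HB.instance Definition _ :=
  SubChoice_isSubGroup.Build G (fun x : G => x \in S) subgroup subgroup_closed.

End Subgroups.

Section SubgroupInclusion.
Variables (G : groupType) (S T : groupClosed G) (ST : {subset S <= T}).

Definition sgincl (x : subgroup S) : subgroup T := Subgroup (ST (sgvalP x)).

Lemma sginclM : {morph sgincl : x y / x * y}.
Proof. by move=> x y; apply: val_inj. Qed.

Lemma sgincl1 : sgincl 1 = 1.
Proof. by apply: val_inj. Qed.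

HB.instance Definition _ :=
  isUMagmaMorphism.Build _ _ sgincl (sgincl1, sginclM).

End SubgroupInclusion.

Section QuotientGroups.
Variables (G : groupType) (S : groupClosed G).
Hypothesis nS : forall x y : G, x \in S -> x ^ y \in S.

Definition coset_rel (x y : G) := x^-1 * y \in S.

Lemma coset_rel_equiv : equiv_class_of coset_rel.
Proof.
split=> [x|x y|y x z]; rewrite /coset_rel.
- by rewrite mulVg gpred1.
- by rewrite -gpredV invgM invgK.
- by move=> xy yz; rewrite -[z](mulVKg y) mulgA gpredM.
Qed.

Canonical coset_rel_equiv_rel := EquivRelPack coset_rel_equiv.
Canonical coset_rel_encModRel := defaultEncModRel coset_rel.

(* The unused normality proof lets the group structure below be inferred. *)
Definition quotient_group of (forall x y : G, x \in S -> x ^ y \in S) :=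
  {eq_quot coset_rel}.
Local Notation Q := (quotient_group nS).

HB.instance Definition _ := Choice.on Q.

Definition quo (x : G) : Q := \pi_{eq_quot coset_rel} x.

Lemma quoP x y : quo x = quo y <-> x^-1 * y \in S.
Proof. by split=> [/eqmodP | xy] //; apply/eqmodP. Qed.

Lemma quo_surj (u : Q) : exists x, u = quo x.
Proof. by exists (repr (u : {eq_quot coset_rel})); rewrite /quo reprK. Qed.

Let rep (u : Q) : G := repr (u : {eq_quot coset_rel}).
Let repP x : (rep (quo x))^-1 * x \in S.
Proof. by apply/quoP; rewrite /quo /rep reprK. Qed.

Definition quo_one : Q := quo 1.
Definition quo_mul (u v : Q) : Q := quo (rep u * rep v).
Definition quo_inv (u : Q) : Q := quo (rep u)^-1.

Lemma quo_mulE x y : quo_mul (quo x) (quo y) = quo (x * y).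
Proof.
apply/quoP; have := gpredM _ _ (nS y (repP x)) (repP y).
set a := rep _; set b := rep _ => aby.
have -> : (a * b)^-1 * (x * y) = (b^-1 * y) * (a^-1 * x) ^ y.
  by rewrite /conjg invgM !mulgA mulgK.
by rewrite gpredM ?nS ?repP.
Qed.

Lemma quo_invE x : quo_inv (quo x) = quo x^-1.
Proof.
apply/quoP; rewrite invgK; set a := rep _.
have -> : a * x^-1 = ((a^-1 * x) ^ (x^-1))^-1.
  by rewrite /conjg !(invgM, invgK) !mulgA mulgV mul1g.
by rewrite gpredV nS ?repP.
Qed.

Lemma quo_mulA : associative quo_mul.
Proof.
move=> u v w; have [x ->] := quo_surj u; have [y ->] := quo_surj v.
by have [z ->] := quo_surj w; rewrite !quo_mulE mulgA.
Qed.

Lemma quo_mul1g : left_id quo_one quo_mul.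
Proof. by move=> u; have [x ->] := quo_surj u; rewrite quo_mulE mul1g. Qed.

Lemma quo_mulg1 : right_id quo_one quo_mul.
Proof. by move=> u; have [x ->] := quo_surj u; rewrite quo_mulE mulg1. Qed.

Lemma quo_mulVg : left_inverse quo_one quo_inv quo_mul.
Proof.
by move=> u; have [x ->] := quo_surj u; rewrite quo_invE quo_mulE mulVg.
Qed.

Lemma quo_mulgV : right_inverse quo_one quo_inv quo_mul.
Proof.
by move=> u; have [x ->] := quo_surj u; rewrite quo_invE quo_mulE mulgV.
Qed.

HB.instance Definition _ := isGroup.Build Q
  quo_mulA quo_mul1g quo_mulg1 quo_mulVg quo_mulgV.

Lemma quo_monoid_morphism : monoid_morphism quo.
Proof. by split=> // x y; rewrite -quo_mulE. Qed.

HB.instance Definition _ :=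
  isUMagmaMorphism.Build G Q quo quo_monoid_morphism.

End QuotientGroups.

Section Automorphisms.
Variable G : groupType.

Record aut := Aut {
  aut_fun :> G -> G;
  autM : {morph aut_fun : x y / x * y};
  aut_bij : bijective aut_fun }.

HB.instance Definition _ := gen_eqMixin aut.
HB.instance Definition _ := gen_choiceMixin aut.

Lemma autP (f g : aut) : f =1 g -> f = g.
Proof.
case: f g => [f fM fB] [g gM gB] /= /funext fg; rewrite fg in fM fB *.
by congr Aut; exact: Prop_irrelevance.
Qed.

Lemma aut_fun1 (f : aut) : f 1 = 1.
Proof. by apply: (mulgI (f 1)); rewrite -autM !mulg1. Qed.

HB.instance Definition _ (f : aut) :=
  isUMagmaMorphism.Build G G f (aut_fun1 f, @autM f).

Definition aut_one : aut :=
  @Aut id (fun _ _ => erefl) (Bijective (frefl _) (frefl _)).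

Lemma aut_mulM (f g : aut) : {morph f \o g : x y / x * y}.
Proof. by move=> x y /=; rewrite !autM. Qed.

Definition aut_mul (f g : aut) : aut :=
  Aut (aut_mulM f g) (bij_comp (aut_bij f) (aut_bij g)).

Lemma aut_inv_ex (f : aut) : exists g : aut, cancel f g /\ cancel g f.
Proof.
have [g fK gK] := aut_bij f.
by exists (@Aut g (can2_gmulfM fK gK) (Bijective gK fK)).
Qed.

Definition aut_inv (f : aut) : aut := projT1 (cid (aut_inv_ex f)).

Lemma autK (f : aut) : cancel f (aut_inv f).
Proof. by rewrite /aut_inv; case: cid => g []. Qed.

Lemma autVK (f : aut) : cancel (aut_inv f) f.
Proof. by rewrite /aut_inv; case: cid => g []. Qed.

Fact aut_mulA : associative aut_mul. Proof. by move=> *; exact: autP. Qed.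
Fact aut_mul1g : left_id aut_one aut_mul. Proof. by move=> ?; exact: autP. Qed.
Fact aut_mulg1 : right_id aut_one aut_mul. Proof. by move=> ?; exact: autP. Qed.
Fact aut_mulVg : left_inverse aut_one aut_inv aut_mul.
Proof. by move=> f; apply: autP => x /=; rewrite autK. Qed.
Fact aut_mulgV : right_inverse aut_one aut_inv aut_mul.
Proof. by move=> f; apply: autP => x /=; rewrite autVK. Qed.

HB.instance Definition _ := isGroup.Build aut
  aut_mulA aut_mul1g aut_mulg1 aut_mulVg aut_mulgV.

End Automorphisms.

(* The extension 1 -> N -> G -> H -> 1; N is identified with range ext_in. *)
Record abelian_extension (N G H : groupType) := AbelianExtension {
  ext_in : group_morphism N G;
  ext_out : group_morphism G H;
  ext_in_inj : injective ext_in;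
  ext_out_surj : forall x : H, exists g : G, ext_out g = x;
  ext_exact : range ext_in = [set g | ext_out g = 1];
  ext_abelian : forall m n : N, m * n = n * m }.

Record left_transversal (N G H : groupType) (E : abelian_extension N G H) :=
  LeftTransversal {
    trv :> H -> G;
    trvK : cancel trv (ext_out E);
    trv1 : trv 1 = 1 }.

Section Extension.
Variables (N G H : groupType) (E : abelian_extension N G H).
Local Notation i := (ext_in E).
Local Notation p := (ext_out E).

(* The inverse of ext_in on its range; the value outside is irrelevant. *)
Definition ext_in_inv (g : G) : N := xget 1 [set n | i n = g].

Lemma ext_inK : cancel i ext_in_inv.
Proof.
by move=> n; apply: xget_unique => // m /ext_in_inj.
Qed.

Lemma ext_in_invK g : p g = 1 -> i (ext_in_inv g) = g.
Proof.
move=> g1; have [n _ <-] : range i g by rewrite ext_exact.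
by rewrite ext_inK.
Qed.

Lemma ext_out_in n : p (i n) = 1.
Proof.
have : range i (i n) by exists n.
by rewrite ext_exact.
Qed.

Definition stabilizes_N (c : aut G) : Prop := c @` range i = range i.
Definition fixes_N (c : aut G) : Prop := forall n : N, c (i n) = i n.
Definition induces_on_H (c : aut G) (f : aut H) : Prop :=
  forall g : G, p (c g) = f (p g).

(* Aut_N^H(G), Aut^N(G) and Aut^{N,H}(G), in this order. *)
Definition Aut_N_H : {pred aut G} :=
  fun c => `[< stabilizes_N c /\ induces_on_H c 1 >].
Definition AutN : {pred aut G} := fun c => `[< fixes_N c >].
Definition AutNH : {pred aut G} :=
  fun c => `[< fixes_N c /\ induces_on_H c 1 >].

Lemma fixes_stabilizes c : fixes_N c -> stabilizes_N c.
Proof.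
move=> cN; apply/seteqP; split=> g.
  by case=> _ [n _ <-] <-; rewrite cN; exists n.
by case=> n _ <-; exists (i n); [exists n | exact: cN].
Qed.

Lemma stabilizes1 : stabilizes_N 1.
Proof. by apply: fixes_stabilizes => n. Qed.

Lemma stabilizesM c d : stabilizes_N c -> stabilizes_N d -> stabilizes_N (c * d).
Proof.
rewrite /stabilizes_N => cN dN.
by rewrite -[LHS](@image_comp _ _ _ d c) dN.
Qed.

Lemma stabilizesV c : stabilizes_N c -> stabilizes_N c^-1.
Proof.
rewrite /stabilizes_N => cN; rewrite -{1}cN (@image_comp _ _ _ c).
have -> : c^-1 \o c = id :> (G -> G) by apply/funext=> g; exact: autK.
by rewrite image_id.
Qed.

Lemma induces1 : induces_on_H 1 1. Proof. by []. Qed.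

Lemma inducesM c d f e :
  induces_on_H c f -> induces_on_H d e -> induces_on_H (c * d) (f * e).
Proof. by move=> cf de g; rewrite /= cf de. Qed.

Lemma inducesV c f : induces_on_H c f -> induces_on_H c^-1 f^-1.
Proof.
move=> cf g; apply: (can_inj (autK f)); rewrite -cf.
by rewrite [c _]autVK [RHS]autVK.
Qed.

Lemma fixesM c d : fixes_N c -> fixes_N d -> fixes_N (c * d).
Proof. by move=> cN dN n; rewrite /= dN cN. Qed.

Lemma fixesV c : fixes_N c -> fixes_N c^-1.
Proof. by move=> cN n; rewrite -[in LHS]cN [LHS]autK. Qed.

Fact Aut_N_H_M : mulg_closed Aut_N_H.
Proof.
move=> c d /asboolP[cN cH] /asboolP[dN dH]; apply/asboolP.
by split; [exact: stabilizesM | rewrite -[1]mulg1; exact: inducesM].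
Qed.
Fact Aut_N_H_1 : 1 \in Aut_N_H.
Proof. by apply/asboolP; split; [exact: stabilizes1 | exact: induces1]. Qed.
Fact Aut_N_H_V : invg_closed Aut_N_H.
Proof.
move=> c /asboolP[cN cH]; apply/asboolP.
by split; [exact: stabilizesV | rewrite -invg1; exact: inducesV].
Qed.
HB.instance Definition _ := isMulClosed.Build _ Aut_N_H Aut_N_H_M.
HB.instance Definition _ := isMul1Closed.Build _ Aut_N_H Aut_N_H_1.
HB.instance Definition _ := isInvClosed.Build _ Aut_N_H Aut_N_H_V.

Fact AutN_M : mulg_closed AutN.
Proof. by move=> c d /asboolP cN /asboolP dN; apply/asboolP/fixesM. Qed.
Fact AutN_1 : 1 \in AutN. Proof. exact/asboolP. Qed.
Fact AutN_V : invg_closed AutN.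
Proof. by move=> c /asboolP cN; apply/asboolP/fixesV. Qed.
HB.instance Definition _ := isMulClosed.Build _ AutN AutN_M.
HB.instance Definition _ := isMul1Closed.Build _ AutN AutN_1.
HB.instance Definition _ := isInvClosed.Build _ AutN AutN_V.

Fact AutNH_M : mulg_closed AutNH.
Proof.
move=> c d /asboolP[cN cH] /asboolP[dN dH]; apply/asboolP.
by split; [exact: fixesM | rewrite -[1]mulg1; exact: inducesM].
Qed.
Fact AutNH_1 : 1 \in AutNH. Proof. exact/asboolP. Qed.
Fact AutNH_V : invg_closed AutNH.
Proof.
move=> c /asboolP[cN cH]; apply/asboolP.
by split; [exact: fixesV | rewrite -invg1; exact: inducesV].
Qed.
HB.instance Definition _ := isMulClosed.Build _ AutNH AutNH_M.
HB.instance Definition _ := isMul1Closed.Build _ AutNH AutNH_1.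
HB.instance Definition _ := isInvClosed.Build _ AutNH AutNH_V.

Fact AutNH_sub1 : {subset AutNH <= Aut_N_H}.
Proof.
by move=> c /asboolP[cN cH]; apply/asboolP; split=> //; exact: fixes_stabilizes.
Qed.
Fact AutNH_sub2 : {subset AutNH <= AutN}.
Proof. by move=> c /asboolP[cN cH]; apply/asboolP. Qed.

Definition incl1 : group_morphism (subgroup AutNH) (subgroup Aut_N_H) :=
  sgincl AutNH_sub1.
Definition incl2 : group_morphism (subgroup AutNH) (subgroup AutN) :=
  sgincl AutNH_sub2.

Lemma stab_restr_in c n :
  stabilizes_N c -> i (ext_in_inv (c (i n))) = c (i n).
Proof.
move=> cN; have [m _ <-] : range i (c (i n)).
  by rewrite -cN; exists (i n) => //; exists n.
by rewrite ext_inK.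
Qed.

Section Restriction.
Variables (c : aut G) (cN : stabilizes_N c).

Let r (n : N) := ext_in_inv (c (i n)).

Let rM : {morph r : m n / m * n}.
Proof.
move=> m n; apply: (@ext_in_inj _ _ _ E).
by rewrite gmulfM !stab_restr_in // !gmulfM.
Qed.

Let rB : bijective r.
Proof.
exists (fun n => ext_in_inv (c^-1 (i n))) => n.
  by rewrite /r stab_restr_in // [c^-1 _]autK ext_inK.
by rewrite /r stab_restr_in ?[c _]autVK ?ext_inK //; exact: stabilizesV.
Qed.

Definition restr_N : aut N := Aut rM rB.

Lemma restr_NE n : i (restr_N n) = c (i n).
Proof. exact: stab_restr_in. Qed.

End Restriction.

Section Induced.
Variables (c : aut G) (cN : stabilizes_N c).

(* x |-> p (c g), where g is any element with p g = x *)
Let q (d : aut G) (x : H) : H := p (d (xget 1 [set g | p g = x])).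

Let qE d g : stabilizes_N d -> q d (p g) = p (d g).
Proof.
move=> dN; rewrite /q; set g' := xget _ _.
have gg' : p g' = p g by apply: (@xgetI _ 1 [set h | p h = p g] g).
have : range i (g'^-1 * g) by rewrite ext_exact /= gmulfM gmulfV gg' mulVg.
move=> [n _ ng]; have -> : g = g' * i n by rewrite ng mulVKg.
by rewrite autM gmulfM -(stab_restr_in _ dN) ext_out_in mulg1.
Qed.

Let qM : {morph q c : x y / x * y}.
Proof.
move=> x y; have [g <-] := @ext_out_surj _ _ _ E x.
have [h <-] := @ext_out_surj _ _ _ E y.
by rewrite -gmulfM !qE // -gmulfM -gmulfM.
Qed.

Let qB : bijective (q c).
Proof.
exists (q c^-1) => x; have [g <-] := @ext_out_surj _ _ _ E x.
  by rewrite !qE //; [congr (p _); exact: autK | exact: stabilizesV].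
by rewrite !qE //; [congr (p _); exact: autVK | exact: stabilizesV].
Qed.

Definition induced_H : aut H := Aut qM qB.

Lemma induced_HE : induces_on_H c induced_H.
Proof. by move=> g; rewrite -qE. Qed.

End Induced.

Variable t : left_transversal E.

Definition act (n : N) (x : H) : N := ext_in_inv ((t x)^-1 * i n * t x).

Lemma actE n x : i (act n x) = i n ^ t x.
Proof.
rewrite /act ext_in_invK /conjg ?mulgA //.
by rewrite !gmulfM ext_out_in mulg1 gmulfV mulVg.
Qed.

Lemma act_lift n x g : p g = x -> i (act n x) = i n ^ g.
Proof.
move=> gx; have : range i ((t x)^-1 * g).
  by rewrite ext_exact /= gmulfM gmulfV trvK gx mulVg.
move=> [m _ mg]; have -> : g = t x * i m by rewrite mg mulVKg.
rewrite conjgM -actE /conjg -!gmulfM -gmulfV -gmulfM; congr (i _).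
by rewrite (ext_abelian E (act n x)) mulKg.
Qed.

Lemma actM m n x : act (m * n) x = act m x * act n x.
Proof.
by apply: (@ext_in_inj _ _ _ E); rewrite gmulfM !actE gmulfM conjMg.
Qed.

Lemma act1n x : act 1 x = 1.
Proof. by apply: (mulgI (act 1 x)); rewrite -actM !mulg1. Qed.

Lemma actV n x : act n^-1 x = (act n x)^-1.
Proof. by apply: (mulgI (act n x)); rewrite -actM !mulgV act1n. Qed.

Lemma act1 n : act n 1 = n.
Proof. by apply: (@ext_in_inj _ _ _ E); rewrite actE trv1 conjg1. Qed.

Definition compatible (th : aut N) (ph : aut H) : Prop :=
  forall (n : N) (x : H), th (act n x) = act (th n) (ph x).

Lemma compatible1 : compatible 1 1. Proof. by []. Qed.

Lemma compatibleM th ph th' ph' :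
  compatible th ph -> compatible th' ph' -> compatible (th * th') (ph * ph').
Proof. by move=> h h' n x; rewrite /= h' h. Qed.

Lemma compatibleV th ph : compatible th ph -> compatible th^-1 ph^-1.
Proof.
move=> h n x; apply: (can_inj (autK th)); rewrite h.
by rewrite [LHS]autVK [th _]autVK [ph _]autVK.
Qed.

Definition C1 : {pred aut N} := fun th => `[< compatible th 1 >].
Definition C2 : {pred aut H} := fun ph => `[< compatible 1 ph >].

Fact C1_M : mulg_closed C1.
Proof.
move=> f g /asboolP fP /asboolP gP; apply/asboolP.
by rewrite -[1]mulg1; exact: compatibleM.
Qed.
Fact C1_1 : 1 \in C1. Proof. exact/asboolP/compatible1. Qed.
Fact C1_V : invg_closed C1.
Proof.
by move=> f /asboolP fP; apply/asboolP; rewrite -invg1; exact: compatibleV.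
Qed.
HB.instance Definition _ := isMulClosed.Build _ C1 C1_M.
HB.instance Definition _ := isMul1Closed.Build _ C1 C1_1.
HB.instance Definition _ := isInvClosed.Build _ C1 C1_V.

Fact C2_M : mulg_closed C2.
Proof.
move=> f g /asboolP fP /asboolP gP; apply/asboolP.
by rewrite -[1]mulg1; exact: compatibleM.
Qed.
Fact C2_1 : 1 \in C2. Proof. exact/asboolP/compatible1. Qed.
Fact C2_V : invg_closed C2.
Proof.
by move=> f /asboolP fP; apply/asboolP; rewrite -invg1; exact: compatibleV.
Qed.
HB.instance Definition _ := isMulClosed.Build _ C2 C2_M.
HB.instance Definition _ := isMul1Closed.Build _ C2 C2_1.
HB.instance Definition _ := isInvClosed.Build _ C2 C2_V.

Fact Aut_N_H_stab (c : subgroup Aut_N_H) : stabilizes_N (sgval c).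
Proof. by have /asboolP[] := sgvalP c. Qed.

Fact AutN_stab (c : subgroup AutN) : stabilizes_N (sgval c).
Proof. by have /asboolP/fixes_stabilizes := sgvalP c. Qed.

Fact tau1_C1 (c : subgroup Aut_N_H) : restr_N (Aut_N_H_stab c) \in C1.
Proof.
apply/asboolP => n x; apply: (@ext_in_inj _ _ _ E).
have /asboolP[_ cH] := sgvalP c.
rewrite restr_NE actE [LHS]gmulfJ (@act_lift _ _ (sgval c (t x))).
  by rewrite restr_NE.
by rewrite cH trvK.
Qed.

Definition tau1_fun (c : subgroup Aut_N_H) : subgroup C1 :=
  Subgroup (tau1_C1 c).

Fact tau1_morphism : monoid_morphism tau1_fun.
Proof.
split=> [|c d]; apply: val_inj; apply: autP => n.
  by apply: (@ext_in_inj _ _ _ E); rewrite restr_NE.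
apply: (@ext_in_inj _ _ _ E); rewrite [LHS]restr_NE.
rewrite [RHS](restr_NE (Aut_N_H_stab c)).
by congr (sgval c _); apply/esym/(restr_NE (Aut_N_H_stab d)).
Qed.
HB.instance Definition _ :=
  isUMagmaMorphism.Build _ _ tau1_fun tau1_morphism.
Definition tau1 : group_morphism (subgroup Aut_N_H) (subgroup C1) := tau1_fun.

Fact tau2_C2 (c : subgroup AutN) : induced_H (AutN_stab c) \in C2.
Proof.
apply/asboolP => n x; apply: (@ext_in_inj _ _ _ E).
have /asboolP cN := sgvalP c.
rewrite (@act_lift _ (induced_H _ x) (sgval c (t x))).
  change (i (act n x) = i n ^ sgval c (t x)).
  rewrite -[X in X ^ _](cN n) -[RHS](gmulfJ (sgval c : aut G)) -actE.
  exact/esym/cN.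
by rewrite (induced_HE (AutN_stab c)) trvK.
Qed.

Definition tau2_fun (c : subgroup AutN) : subgroup C2 := Subgroup (tau2_C2 c).

Fact tau2_morphism : monoid_morphism tau2_fun.
Proof.
split=> [|c d]; apply: val_inj; apply: autP => x;
  have [g <-] := @ext_out_surj _ _ _ E x.
  exact/esym/(induced_HE (AutN_stab 1)).
rewrite -[LHS](induced_HE (AutN_stab (c * d))).
rewrite [LHS](induced_HE (AutN_stab c)).
by congr (induced_H _ _); exact: (induced_HE (AutN_stab d)).
Qed.
HB.instance Definition _ :=
  isUMagmaMorphism.Build _ _ tau2_fun tau2_morphism.
Definition tau2 : group_morphism (subgroup AutN) (subgroup C2) := tau2_fun.

Record cocycle := Cocycle {
  coc :> H -> H -> N;
  cocx1 : forall x, coc x 1 = 1;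
  coc1x : forall x, coc 1 x = 1;
  cocP : forall x y z,
    coc (x * y) z * act (coc x y) z = coc x (y * z) * coc y z }.

HB.instance Definition _ := gen_eqMixin cocycle.
HB.instance Definition _ := gen_choiceMixin cocycle.

Lemma cocycleP (f g : cocycle) : (forall x y, f x y = g x y) -> f = g.
Proof.
case: f g => [f f1 f2 f3] [g g1 g2 g3] /= fg.
have {}fg : f = g by apply/funext => x; apply/funext => y.
by rewrite fg in f1 f2 f3 *; congr Cocycle; exact: Prop_irrelevance.
Qed.

Local Notation mulNC := (@ext_abelian _ _ _ E).

Lemma mulNACA (a b c d : N) : a * b * (c * d) = a * c * (b * d).
Proof. by rewrite !mulgA -(mulgA a) (mulNC b) mulgA. Qed.

Fact coc_oneP (x y z : H) : 1 * act 1 z = 1 * 1.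
Proof. by rewrite act1n. Qed.

Definition coc_one : cocycle :=
  @Cocycle (fun _ _ => 1) (fun=> erefl) (fun=> erefl) coc_oneP.

Section CocycleMul.
Variables f g : cocycle.
Let m (x y : H) := f x y * g x y.
Fact coc_mulx1 x : m x 1 = 1. Proof. by rewrite /m !cocx1 mulg1. Qed.
Fact coc_mul1x x : m 1 x = 1. Proof. by rewrite /m !coc1x mulg1. Qed.
Fact coc_mulP x y z : m (x * y) z * act (m x y) z = m x (y * z) * m y z.
Proof. by rewrite /m actM mulNACA !cocP mulNACA. Qed.
Definition coc_mul : cocycle := Cocycle coc_mulx1 coc_mul1x coc_mulP.
End CocycleMul.

Section CocycleInv.
Variable f : cocycle.
Let v (x y : H) := (f x y)^-1.
Fact coc_invx1 x : v x 1 = 1. Proof. by rewrite /v cocx1 invg1. Qed.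
Fact coc_inv1x x : v 1 x = 1. Proof. by rewrite /v coc1x invg1. Qed.
Fact coc_invP x y z : v (x * y) z * act (v x y) z = v x (y * z) * v y z.
Proof. by rewrite /v actV -!invgM mulNC cocP mulNC. Qed.
Definition coc_inv : cocycle := Cocycle coc_invx1 coc_inv1x coc_invP.
End CocycleInv.

Fact coc_mulA : associative coc_mul.
Proof. by move=> f g h; apply: cocycleP => x y /=; rewrite mulgA. Qed.
Fact coc_mul1g : left_id coc_one coc_mul.
Proof. by move=> f; apply: cocycleP => x y /=; rewrite mul1g. Qed.
Fact coc_mulg1 : right_id coc_one coc_mul.
Proof. by move=> f; apply: cocycleP => x y /=; rewrite mulg1. Qed.
Fact coc_mulVg : left_inverse coc_one coc_inv coc_mul.
Proof. by move=> f; apply: cocycleP => x y /=; rewrite mulVg. Qed.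
Fact coc_mulgV : right_inverse coc_one coc_inv coc_mul.
Proof. by move=> f; apply: cocycleP => x y /=; rewrite mulgV. Qed.

HB.instance Definition _ := isGroup.Build cocycle
  coc_mulA coc_mul1g coc_mulg1 coc_mulVg coc_mulgV.

Definition is_coboundary (f : H -> H -> N) : Prop :=
  exists2 chi : H -> N, chi 1 = 1 &
    forall x y, f x y = act (chi x) y * chi y * (chi (x * y))^-1.

Definition coboundary : {pred cocycle} := fun f => `[< is_coboundary f >].

Fact coboundary_M : mulg_closed coboundary.
Proof.
move=> f g /asboolP[a a1 aP] /asboolP[b b1 bP]; apply/asboolP.
exists (fun x => a x * b x) => [|x y]; first by rewrite a1 b1 mulg1.
rewrite /= aP bP actM invgM (mulNC (b _)^-1) mulNACA.
by congr (_ * _); rewrite mulNACA.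
Qed.
Fact coboundary_1 : 1 \in coboundary.
Proof.
by apply/asboolP; exists (fun=> 1) => // x y; rewrite act1n mulg1 mulgV.
Qed.
Fact coboundary_V : invg_closed coboundary.
Proof.
move=> f /asboolP[a a1 aP]; apply/asboolP.
exists (fun x => (a x)^-1) => [|x y]; first by rewrite a1 invg1.
by rewrite /= aP actV -!invgM mulNC (mulNC (act _ _)).
Qed.
HB.instance Definition _ := isMulClosed.Build _ coboundary coboundary_M.
HB.instance Definition _ := isMul1Closed.Build _ coboundary coboundary_1.
HB.instance Definition _ := isInvClosed.Build _ coboundary coboundary_V.

Fact coboundary_normal (f g : cocycle) :
  f \in coboundary -> f ^ g \in coboundary.
Proof.
suff -> : f ^ g = f by [].
by apply: cocycleP => x y /=; rewrite [RHS]/= (mulNC (f x y)) mulKg.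
Qed.

Definition H2 := quotient_group coboundary_normal.
HB.instance Definition _ := Group.on H2.

Definition cclass (f : cocycle) : H2 := quo coboundary_normal f.

Lemma cclass_eq1 (f : cocycle) : cclass f = 1 <-> is_coboundary f.
Proof.
apply: iff_trans (_ : f^-1 * 1 \in coboundary <-> _).
  exact: (quoP coboundary_normal).
rewrite mulg1; apply: iff_trans (_ : f \in coboundary <-> _).
  by rewrite (gpredV coboundary f).
by split=> /asboolP.
Qed.

Definition mu (x y : H) : N := ext_in_inv ((t (x * y))^-1 * (t x * t y)).

Lemma muE x y : t (x * y) * i (mu x y) = t x * t y.
Proof.
rewrite /mu ext_in_invK ?mulVKg //.
by rewrite !gmulfM gmulfV !trvK mulVg.
Qed.

Lemma mux1 x : mu x 1 = 1.
Proof.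
apply: (@ext_in_inj _ _ _ E); apply: (mulgI (t (x * 1))).
by rewrite muE mulg1 trv1 gmulf1 .
Qed.

Lemma mu1x x : mu 1 x = 1.
Proof.
apply: (@ext_in_inj _ _ _ E); apply: (mulgI (t (1 * x))).
by rewrite muE mul1g trv1 gmulf1 mulg1 mul1g.
Qed.

Lemma muP x y z : mu (x * y) z * act (mu x y) z = mu x (y * z) * mu y z.
Proof.
apply: (@ext_in_inj _ _ _ E); apply: (mulgI (t (x * y * z))).
have -> : t (x * y * z) * i (mu (x * y) z * act (mu x y) z) = t x * t y * t z.
  by rewrite gmulfM mulgA muE actE /conjg -mulgA mulVKg mulgA muE.
by rewrite -[x * y * z]mulgA gmulfM [RHS]mulgA muE -[RHS]mulgA muE mulgA.
Qed.

Definition k1_fun (th : aut N) (x y : H) : N := mu x y * th (mu x y)^-1.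
Definition k2_fun (ph : aut H) (x y : H) : N :=
  mu (ph x) (ph y) * (mu x y)^-1.

Fact k1x1 th x : k1_fun th x 1 = 1.
Proof. by rewrite /k1_fun mux1 invg1 gmulf1 mulg1. Qed.
Fact k11x th x : k1_fun th 1 x = 1.
Proof. by rewrite /k1_fun mu1x invg1 gmulf1 mulg1. Qed.
Fact k1P (th : subgroup C1) x y z (k := k1_fun (sgval th)) :
  k (x * y) z * act (k x y) z = k x (y * z) * k y z.
Proof.
have /asboolP thP := sgvalP th; rewrite /k /k1_fun.
rewrite actM mulNACA muP [RHS]mulNACA; congr (_ * _).
rewrite -[act (sgval th _) z](thP _ z) -!gmulfM actV -!invgM.
by rewrite mulNC muP mulNC.
Qed.

Fact k2x1 ph x : k2_fun ph x 1 = 1.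
Proof. by rewrite /k2_fun gmulf1 !mux1 mulgV. Qed.
Fact k21x ph x : k2_fun ph 1 x = 1.
Proof. by rewrite /k2_fun gmulf1 !mu1x mulgV. Qed.
Fact k2P (ph : subgroup C2) x y z (k := k2_fun (sgval ph)) :
  k (x * y) z * act (k x y) z = k x (y * z) * k y z.
Proof.
have /asboolP phP := sgvalP ph; rewrite /k /k2_fun.
rewrite actM mulNACA [RHS]mulNACA.
rewrite [act (mu (sgval ph x) _) z](phP _ z) !autM muP.
by congr (_ * _); rewrite actV -!invgM mulNC muP mulNC.
Qed.

Definition k1 (th : subgroup C1) : cocycle :=
  Cocycle (k1x1 (sgval th)) (k11x (sgval th)) (k1P th).
Definition k2 (ph : subgroup C2) : cocycle :=
  Cocycle (k2x1 (sgval ph)) (k21x (sgval ph)) (k2P ph).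

Definition lambda1 (th : subgroup C1) : H2 := cclass (k1 th).
Definition lambda2 (ph : subgroup C2) : H2 := cclass (k2 ph).

End Extension.

(* Image = kernel. Here g need not be a homomorphism, and its domain need not
   be a group. *)
Definition exact_at (A B : Type) (C : groupType) (f : A -> B) (g : B -> C) :
  Prop := range f = [set b | g b = 1].

(* Main.v *)
Require Import Defs.
From mathcomp Require Import all_boot.
From mathcomp Require Import boolp classical_sets.

(** For a compatible pair (theta, phi), an automorphism of G restricting to
    theta on N and inducing phi on H is determined by its values on the
    transversal, c (t x) = t (phi x) * (s x)^-1 with s : H -> N.  Such a c is
    multiplicative iff mu (phi x) (phi y) * theta (mu x y)^-1 is the coboundary
    of s for the action of H on N through phi.  For (theta, 1) and (1, phi) this
    action is the original one, so the criterion says that lambda_i is trivial. *)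

Set Implicit Arguments.
Unset Strict Implicit.
Unset Printing Implicit Defensive.

Local Open Scope classical_set_scope.
Local Open Scope group_scope.

Section Lifting.
Variables (N G H : groupType) (E : abelian_extension N G H).
Variable t : left_transversal E.
Local Notation i := (ext_in E).
Local Notation p := (ext_out E).
Local Notation mulNC := (@ext_abelian _ _ _ E).

Definition restricts_to (c : aut G) (th : aut N) : Prop :=
  forall n, c (i n) = i (th n).

Lemma restricts_stabilizes c th : restricts_to c th -> stabilizes_N E c.
Proof.
move=> cth; apply/seteqP; split=> [_ [_ [n _ <-] <-]|_ [n _ <-]].
  by exists (th n) => //; rewrite cth.
by exists (i (th^-1 n)); [exists (th^-1 n) | rewrite cth [th _]autVK].
Qed.

(** The second coordinate of [g] when G is identified with H x N through [t x * i n]. *)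
Definition npart (g : G) : N := ext_in_inv E ((t (p g))^-1 * g).

Lemma trv_npart g : t (p g) * i (npart g) = g.
Proof.
by rewrite /npart ext_in_invK ?mulVKg // gmulfM gmulfV trvK mulVg.
Qed.

Lemma ext_out_trv x n : p (t x * i n) = x.
Proof. by rewrite gmulfM ext_out_in mulg1 trvK. Qed.

Lemma npart_trv x n : npart (t x * i n) = n.
Proof. by rewrite /npart ext_out_trv mulKg ext_inK. Qed.

Lemma npart_in n : npart (i n) = n.
Proof. by rewrite -[i n]mul1g -(trv1 t) npart_trv. Qed.

(** Moving [i m] past [t y] conjugates it, which is the action of [y]; [mu] is the factor set of the
    extension. *)
Lemma mul_trv x y m n :
  t x * i m * (t y * i n) = t (x * y) * i (mu t x y * act t m y * n).
Proof.
by rewrite !gmulfM actE /conjg !mulgA muE mulgK.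
Qed.

Lemma npartM g h :
  npart (g * h) = mu t (p g) (p h) * act t (npart g) (p h) * npart h.
Proof.
by rewrite -{1}(trv_npart g) -{1}(trv_npart h) mul_trv npart_trv.
Qed.

Section Criterion.
Variables (th : aut N) (ph : aut H).

Definition twisted_coboundary (s : H -> N) : Prop :=
  forall x y, mu t (ph x) (ph y) * th (mu t x y)^-1 =
    act t (s x) (ph y) * s y * (s (x * y))^-1.

Section Lift.
Variable s : H -> N.

(** The value forced at [g = t x * i n] by [t x |-> t (ph x) * i (s x)^-1] and
    [i n |-> i (th n)]. *)
Definition lift (g : G) : G := t (ph (p g)) * i ((s (p g))^-1 * th (npart g)).

Lemma lift_bij : bijective lift.
Proof.
(* The inverse solves for the H-coordinate first, then for the N-coordinate. *)
exists (fun g => t (ph^-1 (p g)) * i (th^-1 (s (ph^-1 (p g)) * npart g))) => g.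
  rewrite /lift ext_out_trv npart_trv [ph^-1 _]autK mulVKg [th^-1 _]autK.
  exact: trv_npart.
rewrite /lift ext_out_trv npart_trv [ph _]autVK [th _]autVK mulKg.
exact: trv_npart.
Qed.

Hypothesis thph : compatible t th ph.
Hypothesis sP : twisted_coboundary s.

Lemma twisted_coboundaryE x y :
  s (x * y) * mu t (ph x) (ph y) =
  th (mu t x y) * (s y * act t (s x) (ph y)).
Proof.
rewrite -(mulgVK (th (mu t x y)) (mu t (ph x) (ph y))) -gmulfV sP.
rewrite mulNC (mulNC _ (th _)) -mulgA mulgVK.
by rewrite (mulNC (s y)).
Qed.

Lemma liftM : {morph lift : g h / g * h}.
Proof.
move=> g h; rewrite /lift mul_trv npartM [p _]gmulfM (autM ph); congr (_ * i _).
set x := p g; set y := p h.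
(* This cancels the inverse on the left and creates on the right the product that
   [twisted_coboundaryE] rewrites. *)
apply: (mulgI (s (x * y))); rewrite mulVKg !mulgA twisted_coboundaryE.
rewrite actM actV !autM thph -!mulgA mulVKg; congr (_ * _).
by rewrite (mulNC (s y)) -!mulgA (mulNC (th (npart h))) mulKg.
Qed.

End Lift.

Definition lifts (c : aut G) : Prop :=
  restricts_to c th /\ induces_on_H E c ph.

Lemma liftP : compatible t th ph ->
  (exists c, lifts c) <-> (exists2 s, s 1 = 1 & twisted_coboundary s).
Proof.
move=> thph; split=> [[c [cN cH]]|[s s1 sP]]; last first.
  exists (Aut (liftM thph sP) (lift_bij s)); split=> [n|g] /=.
    by rewrite /lift ext_out_in gmulf1 trv1 mul1g s1 invg1 mul1g npart_in.
  by rewrite /lift ext_out_trv.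
(* [c (t x)] and [t (ph x)] have the same image in H, so they differ by an element of N. *)
pose s x := ext_in_inv E ((c (t x))^-1 * t (ph x)).
have cE x : c (t x) = t (ph x) * i (s x)^-1.
  rewrite gmulfV ext_in_invK; first by rewrite invgM invgK mulVKg.
  by rewrite gmulfM gmulfV cH !trvK mulVg.
exists s => [|x y].
  rewrite /s gmulf1 !trv1 gmulf1 mulVg.
  by apply: (@ext_in_inj _ _ _ E); rewrite ext_in_invK gmulf1.
(* Applying [c] to the equation defining [mu] and comparing N-coordinates gives the coboundary
   identity. *)
have := congr1 c (muE t x y).
rewrite !autM cN !cE mul_trv -mulgA -gmulfM autM.
move/mulgI/(@ext_in_inj _ _ _ E); rewrite actV => e.
have -> : mu t (ph x) (ph y) =
    (s (x * y))^-1 * th (mu t x y) * s y * act t (s x) (ph y).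
  by rewrite e !mulgVK.
rewrite gmulfV mulNC (mulNC (s (x * y))^-1) -!mulgA mulKg mulNC.
by rewrite (mulNC (s y)) mulgA.
Qed.

End Criterion.

Lemma lambda1_eq1 (th : subgroup (C1 t)) :
  lambda1 th = 1 <-> exists c, lifts (sgval th) 1 c.
Proof.
have /asboolP thP := sgvalP th.
(* For [ph = 1] the twisted condition unfolds to [is_coboundary (k1 th)]. *)
exact: iff_trans (cclass_eq1 (k1 th)) (iff_sym (liftP thP)).
Qed.

Lemma lambda2_eq1 (ph : subgroup (C2 t)) :
  lambda2 ph = 1 <-> exists c, lifts 1 (sgval ph) c.
Proof.
have /asboolP phP := sgvalP ph.
apply: iff_trans (cclass_eq1 (k2 ph)) (iff_trans _ (iff_sym (liftP phP))).
(* Compatibility of [(1, ph)] says that [ph y] acts on N as [y] does, which removes the twist. *)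
by split=> -[s s1 sP]; exists s => // x y;
  have := sP x y; rewrite -[act t (s x) (sgval ph y)](phP (s x) y).
Qed.

Lemma tau1_lifts (c : subgroup (Aut_N_H E)) :
  lifts (sgval (tau1 t c)) 1 (sgval c).
Proof.
have /asboolP[_ cH] := sgvalP c.
by split=> // n; rewrite -(restr_NE (Aut_N_H_stab c)).
Qed.

Lemma tau2_lifts (c : subgroup (AutN E)) :
  lifts 1 (sgval (tau2 t c)) (sgval c).
Proof.
have /asboolP cN := sgvalP c.
by split=> //; exact: (induced_HE (AutN_stab c)).
Qed.

(** Injectivity of [i] is the reason; this identifies [tau1 t c] from any pair that [c] lifts. *)
Lemma lifts_restr_inj th th' ph ph' c :
  lifts th ph c -> lifts th' ph' c -> th = th'.
Proof.
move=> [cth _] [cth' _]; apply: autP => n.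
by apply: (@ext_in_inj _ _ _ E); rewrite -cth -cth'.
Qed.

(** The counterpart for [tau2], by surjectivity of [p]. *)
Lemma lifts_induced_inj th th' ph ph' c :
  lifts th ph c -> lifts th' ph' c -> ph = ph'.
Proof.
move=> [_ cph] [_ cph']; apply: autP => x.
by have [g <-] := ext_out_surj E x; rewrite -cph -cph'.
Qed.

Lemma range_tau1 (th : subgroup (C1 t)) :
  range (tau1 t) th <-> exists c, lifts (sgval th) 1 c.
Proof.
split=> [[c _ <-]|[c cth]]; first by exists (sgval c); exact: tau1_lifts.
have cN : c \in Aut_N_H E.
  by case: cth => cN cH; apply/asboolP; split=> //;
    exact: restricts_stabilizes cN.
exists (Subgroup cN) => //; apply: val_inj.
exact: lifts_restr_inj (tau1_lifts (Subgroup cN)) cth.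
Qed.

Lemma range_tau2 (ph : subgroup (C2 t)) :
  range (tau2 t) ph <-> exists c, lifts 1 (sgval ph) c.
Proof.
split=> [[c _ <-]|[c cph]]; first by exists (sgval c); exact: tau2_lifts.
have cN : c \in AutN E by case: cph => cN _; exact/asboolP.
exists (Subgroup cN) => //; apply: val_inj.
exact: lifts_induced_inj (tau2_lifts (Subgroup cN)) cph.
Qed.

Lemma tau1_eq1 (c : subgroup (Aut_N_H E)) :
  tau1 t c = 1 <-> sgval c \in AutNH E.
Proof.
have cl := tau1_lifts c; split=> [c1|/asboolP cNH].
  by apply/asboolP; rewrite c1 in cl.
(* Membership in [AutNH] is [lifts 1 1] up to unfolding. *)
by apply: val_inj; exact: (lifts_restr_inj cl (cNH : lifts 1 1 (sgval c))).
Qed.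

Lemma tau2_eq1 (c : subgroup (AutN E)) :
  tau2 t c = 1 <-> sgval c \in AutNH E.
Proof.
have cl := tau2_lifts c; split=> [c1|/asboolP cNH].
  by apply/asboolP; rewrite c1 in cl.
by apply: val_inj; exact: (lifts_induced_inj cl (cNH : lifts 1 1 (sgval c))).
Qed.

End Lifting.

Section InclusionRange.
Variables (G : groupType) (S T : groupClosed G) (ST : {subset S <= T}).

Lemma sgincl_inj : injective (sgincl ST).
Proof. by move=> x y /(congr1 val) xy; exact: val_inj. Qed.

Lemma range_sgincl (x : subgroup T) :
  range (sgincl ST) x <-> sgval x \in S.
Proof.
split=> [[y _ <-]|xS]; first exact: sgvalP.
by exists (Subgroup xS) => //; exact: val_inj.
Qed.

End InclusionRange.

Lemma exact_atP (A B : Type) (C : groupType) (f : A -> B) (g : B -> C) :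
  (forall b, range f b <-> g b = 1) -> exact_at f g.
Proof. by move=> fg; apply/funext => b; exact/propext. Qed.

Theorem theorem1 (N G H : groupType) (E : abelian_extension N G H)
    (t : left_transversal E) :
  (injective (incl1 E) /\
   exact_at (incl1 E) (tau1 t) /\
   exact_at (tau1 t) (@lambda1 N G H E t)) /\
  (injective (incl2 E) /\
   exact_at (incl2 E) (tau2 t) /\
   exact_at (tau2 t) (@lambda2 N G H E t)).
Proof.
(* Image and kernel are given by one condition: membership in [AutNH] at the middle group, existence
   of a lift at [C1] and [C2]. *)
split; split; [exact: sgincl_inj | split | exact: sgincl_inj | split];
  apply: exact_atP => x.
- exact: iff_trans (range_sgincl _ x) (iff_sym (tau1_eq1 t x)).
- exact: iff_trans (range_tau1 x) (iff_sym (lambda1_eq1 x)).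
- exact: iff_trans (range_sgincl _ x) (iff_sym (tau2_eq1 t x)).
- exact: iff_trans (range_tau2 x) (iff_sym (lambda2_eq1 x)).
Qed.
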